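(* Suppose Assumption A holds: $E[J^2]<\infty$, $E[I^2]<\infty$, $E[X]=1$, $E[X^3]<\infty$. Suppose the Markov chain $(Y_n)$ is irreducible and aperiodic, and that $\theta=\frac{2}{\sigma^2}(\mu+\nu-\rho)<0$. Then the stationary distribution $\pi$ of $(Y_n)$ satisfies $$\pi(0)=\frac{\mu+\nu-\rho}{\nu-\rho}.$$
   Context: Let $I,J,K,X$ be $\mathbb N_0$-valued random variables, $\mathbb N_0=\{0,1,2,\dots\}$, with $P(J>0)=1$ and $K\sim\mathrm{Geo}(1-p)$ for some $0<p<1$, i.e. $P(K=k)=(1-p)p^k$ for $k\ge 0$. Let $(I_n)$, $(J_n)$, $(K_n)$, $(X_{m,n})$ ($n\ge0$, $m\ge1$) be i.i.d. copies of $I,J,K,X$ respectively, all jointly independent. The branching process $(Y_n)_{n\ge 0}$ is the Markov chain on $\mathbb N_0$ with given $Y_0$ and $$Y_{n+1}=\Bigl(J_n+\sum_{m=1}^{Y_n+I_n-K_n}X_{m,n}\Bigr)\mathbf 1_{\{K_n<Y_n+I_n\}},\qquad n\ge 0.$$ Notation: $\mu=E[I]$, $\nu=E[J]$, $\rho=E[K]=p/(1-p)$, $\sigma^2=\mathrm{Var}(X)$, and it is assumed throughout that $\sigma^2>0$. When $\theta<0$ the chain is positive recurrent, so $\pi$ exists and is unique. *)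

(* Defs.v *)
From HB Require Import structures.
From mathcomp Require Import all_boot all_order all_algebra.
From mathcomp Require Import boolp classical_sets functions reals ereal.
From mathcomp Require Import topology normedtype sequences.
From mathcomp Require Import measure lebesgue_integral probability.

Set Implicit Arguments.
Unset Strict Implicit.
Unset Printing Implicit Defensive.

Import Order.TTheory GRing.Theory Num.Theory.

Local Open Scope classical_set_scope.
Local Open Scope ring_scope.

Section RandomVariables.
Context d (T : measurableType d) (R : realType) (P : probability T R).

Definition natR (Z : T -> nat) : T -> R := fun w => (Z w)%:R.

Definition mean (Z : T -> nat) : R := fine 'E_P[natR Z].

Definition var (Z : T -> nat) : R := fine 'V_P[natR Z].

Definition same_law (Z Z' : {RV P >-> nat}) : Prop :=
  distribution P Z =1 distribution P Z'.

Definition geometric_law (p : R) (K : T -> nat) : Prop :=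
  forall k : nat, P [set w | K w = k] = ((1 - p) * p ^+ k)%:E.

Definition mutually_independent (idx : eqType) (Z : idx -> T -> nat) : Prop :=
  forall (s : seq idx) (A : idx -> set nat), uniq s ->
    P (\bigcap_(a in [set` s]) (Z a @^-1` A a)) =
    (\prod_(a <- s) P (Z a @^-1` A a))%E.

Section BranchingProcess.
(* [X_ m n] stands for $X_{m+1,n}$: the first index of the offspring variables
   is shifted so as to start at 0. *)
Variables (I_ J_ K_ : nat -> T -> nat) (X_ : nat -> nat -> T -> nat).

(* The whole family (I_n), (J_n), (K_n), (X_{m,n}), over a disjoint union of
   index sets. *)
Definition innovation (a : nat + nat + nat + nat * nat) : T -> nat :=
  match a with
  | inl (inl (inl n)) => I_ n
  | inl (inl (inr n)) => J_ n
  | inl (inr n) => K_ n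
  | inr (m, n) => X_ m n
  end.

(* The natural-number subtraction is only used when it is not truncated. *)
Fixpoint branching (Y0 : T -> nat) (n : nat) (w : T) : nat :=
  match n with
  | 0%N => Y0 w
  | n'.+1 =>
    let y := branching Y0 n' w in
    if (K_ n' w < y + I_ n' w)%N
    then (J_ n' w + \sum_(m < y + I_ n' w - K_ n' w) X_ m n' w)%N
    else 0%N
  end.

(* P_y(Y_n = z), the probability for the chain started at Y_0 = y *)
Definition trans_prob (n y z : nat) : \bar R :=
  P [set w | branching (fun=> y) n w = z].

End BranchingProcess.

Definition theta (I J K X : T -> nat) : R :=
  2 / var X * (mean I + mean J - mean K).

End RandomVariables.

Section CountableChains.
Context (R : realType).
(* [p n y z] is the n-step transition probability from y to z. *)
Variable p : nat -> nat -> nat -> \bar R.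

Definition irreducible : Prop :=
  forall y z : nat, exists n : nat, (0 < p n y z)%E.

(* gcd {n >= 1 | p n y y > 0} = 1 for every state y *)
Definition aperiodic : Prop :=
  forall y k : nat,
    (forall n : nat, (0 < n)%N -> (0 < p n y y)%E -> (k %| n)%N) -> k = 1%N.

Definition stationary (pi : probability nat R) : Prop :=
  forall z : nat,
    pi [set z] = (\sum_(0 <= y <oo) pi [set y] * p 1%N y z)%E.

End CountableChains.

(* Main.v *)
Require Import Defs.
From HB Require Import structures.
From mathcomp Require Import all_boot all_order all_algebra.
From mathcomp Require Import boolp classical_sets functions cardinality reals ereal.
From mathcomp Require Import topology normedtype sequences.
From mathcomp Require Import measure lebesgue_integral probability.
From mathcomp Require Import esum numfun measurable_realfun.
From mathcomp Require Import ring lra.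

(** Write f, g, h and phi for the generating functions of X, I, J and of a
stationary law pi, and put N = Y + I with Y of law pi.  Since K is geometric,
summing over K shows that, given N, the next state has generating function
p^N + h(s) \sum_(k < N) (1 - p) p^k f(s)^(N - k), and the geometric sum in it
turns stationarity into the functional equation [stationary_pgf]:
<<
  (f(s) - p) (phi(s) - c) = (1 - p) h(s) f(s) (phi(f(s)) g(f(s)) - c),
>>
where c = phi(p) g(p) is P(K >= N), the probability that the next state is reset
to 0.  The generating function of the next state reduces to p^N at s = 0, as
h(0) = P(J = 0) = 0, whence pi(0) = c ([stationary_atom0]).

It remains to find c.  Differentiating at s = 1 would give
(1 - c)(nu - rho) + mu = 0 at once, but pi may have infinite mean, in which case
phi has no derivative there.  Iterate f instead: let s_(n+1) = f(s_n),
u_n = 1 - s_n and x_n = 1 - phi(s_n).  As f(1 - u) lies between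
1 - u + q u^2 and 1 - u + C u^2 with q > 0 (this is where the variance of X is
positive), u_n tends to 0, and so does x_n.  The functional equation expresses
(x_n - x_(n+1)) / u_n through quantities that all have limits, and its limit
is l = (1 - c)(nu - rho) + mu.  Now u_n decreases like 1/n at the fastest, so
its series diverges, while the increments x_n - x_(n+1) have a convergent sum:
hence l = 0 ([drift_limit_le0] and [functional_equation_drift]).  Finally
mu + nu - rho < 0 makes nu - rho nonzero, and c can be solved for.

The generating function of one step is obtained from the joint independence
of the innovations: the expectation of a product of functions of distinct
innovations factorizes ([independent_prod]). *)

Set Implicit Arguments.
Unset Strict Implicit.
Unset Printing Implicit Defensive.

Import Order.TTheory GRing.Theory Num.Theory.
Import numFieldNormedType.Exports.

Local Open Scope classical_set_scope.
Local Open Scope ring_scope.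

(** * Sequences driven by a quadratically decaying step *)

Lemma quadratic_decay_cvg0 (R : realType) (q : R) (u : R^nat) :
  0 < q -> (forall n, 0 <= u n) ->
  (forall n, u n.+1 <= u n - q * u n ^+ 2) -> u @ \oo --> 0.
Proof.
move=> q0 u0 hu.
have nu : nonincreasing_seq u.
  apply/nonincreasing_seqP => n.
  by apply: (le_trans (hu n)); rewrite gerBl mulr_ge0 ?sqr_ge0 // ltW.
have cu : u @ \oo --> limn u.
  by apply: nonincreasing_is_cvgn => //; exists 0 => _ [n _ <-].
have cu' : (fun n => u n.+1) @ \oo --> limn u by rewrite (cvg_shiftS u).
have cl : (fun n => u n - q * u n ^+ 2) @ \oo --> limn u - q * limn u ^+ 2.
  by apply: cvgB => //; apply: cvgM; [exact: cvg_cst | apply: cvgM].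
have hl : limn u <= limn u - q * limn u ^+ 2.
  rewrite -{1}(cvg_lim _ cu') // -(cvg_lim _ cl) //.
  by apply: ler_lim => //; [exact: cvgP cu' | exact: cvgP cl | near=> n; exact: hu].
suff l0 : limn u = 0 by rewrite -l0.
have : q * limn u ^+ 2 <= 0 by lra.
by rewrite pmulr_rle0 // real_exprn_even_le0 ?num_real //= => /eqP.
Unshelve. all: by end_near. Qed.

(** If l were positive, u_n <= (2/l)(x_n - x_(n+1)) for n >= N, whence
u_N - u_M <= C \sum_(N <= n < M) u_n^2 <= C u_N (2/l)(x_N - x_M); letting M tend
to infinity gives l <= 2 C x_N, which is absurd for large N.  This is the
divergence of the series of u, in a form that avoids series. *)
Lemma drift_limit_le0 (R : realType) (C l : R) (u x : R^nat) :
  0 <= C -> (forall n, 0 < u n) -> u @ \oo --> 0 ->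
  (forall n, u n.+1 <= u n) -> (forall n, u n - C * u n ^+ 2 <= u n.+1) ->
  x @ \oo --> 0 -> (fun n => (x n - x n.+1) / u n) @ \oo --> l -> l <= 0.
Proof.
move=> C0 u0 cu nu hu cx cl; rewrite leNgt; apply/negP => l0.
have [N _ HN] : \forall n \near \oo,
    l / 2 <= (x n - x n.+1) / u n /\ 2 * C * x n < l.
  near=> n; split; near: n.
    by apply: (cvgr_ge l cl); lra.
  have c2 : (fun n => 2 * C * x n) @ \oo --> 2 * C * 0.
    by apply: cvgM => //; exact: cvg_cst.
  by apply: (cvgr_lt _ c2); rewrite mulr0.
have mono m : u (N + m)%N <= u N.
  by elim: m => [|m IH]; rewrite ?addn0 // addnS; exact: le_trans IH.
have step m : l * (u N - u (N + m)%N) <= 2 * C * u N * (x N - x (N + m)%N).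
  elim: m => [|m IH]; first by rewrite addn0 !subrr !mulr0.
  rewrite addnS; have [/= + _] := HN (N + m)%N (leq_addr _ _).
  rewrite ler_pdivlMr // => h1.
  have h2 : l * (u (N + m)%N - u (N + m).+1) <= l * (C * u (N + m)%N ^+ 2).
    by rewrite ler_pM2l // lerBlDl -lerBlDr.
  have h3 : l * (C * u (N + m)%N ^+ 2) <= 2 * (C * u N) * (l / 2 * u (N + m)%N).
    rewrite (_ : _ * (_ * _ ^+ 2) = l * C * u (N + m)%N * u (N + m)%N); last by ring.
    rewrite (_ : 2 * _ * _ = l * C * u (N + m)%N * u N); last by field.
    by apply: ler_wpM2l => //; rewrite !mulr_ge0 // ltW.
  have h4 : 2 * (C * u N) * (l / 2 * u (N + m)%N) <=
            2 * (C * u N) * (x (N + m)%N - x (N + m).+1).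
    by apply: ler_wpM2l => //; rewrite !mulr_ge0 // ltW.
  lra.
have cvsh (v : R^nat) : v @ \oo --> 0 -> (fun m => v (N + m)%N) @ \oo --> 0.
  by rewrite -(cvg_shiftn N v) => cv; under eq_fun do rewrite addnC.
have cL : (fun m => l * (u N - u (N + m)%N)) @ \oo --> l * (u N - 0).
  by apply: cvgM; [exact: cvg_cst | apply: cvgB; [exact: cvg_cst | exact: cvsh]].
have cR : (fun m => 2 * C * u N * (x N - x (N + m)%N)) @ \oo -->
    2 * C * u N * (x N - 0).
  by apply: cvgM; [exact: cvg_cst | apply: cvgB; [exact: cvg_cst | exact: cvsh]].
have : l * (u N - 0) <= 2 * C * u N * (x N - 0).
  rewrite -(cvg_lim _ cL) // -(cvg_lim _ cR) //.
  by apply: ler_lim; [exact: cvgP cL | exact: cvgP cR | near=> m; exact: step].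
have [_ /= h5] := HN N (leqnn _).
rewrite !subr0 mulrAC ler_pM2r // => h6.
by have := le_lt_trans h6 h5; rewrite ltxx.
Unshelve. all: by end_near. Qed.

(** * The functional equation near 1 *)

Section FunctionalEquation.
Context (R : realType).
Implicit Types (p q a C : R) (f g h phi : R -> R).

(** This is the expansion at 1 of a generating function whose law has mean a
and a finite second moment; convexity accounts for the lower bound. *)
Definition expands_at_1 a f :=
  exists C, 0 <= C /\
  forall u : R, 0 <= u <= 1 -> 1 - a * u <= f (1 - u) <= 1 - a * u + C * u ^+ 2.

Lemma expands_at_1_slope a f (u : R^nat) :
  expands_at_1 a f -> (forall n, 0 < u n <= 1) -> u @ \oo --> 0 ->
  (fun n => (1 - f (1 - u n)) / u n) @ \oo --> a.
Proof.
move=> [C [C0 hC]] hu cu.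
apply: (@squeeze_cvgr _ _ _ _ (fun n => a - C * u n) (cst a)).
- near=> n; have /andP[u0 u1] := hu n.
  have /andP[l r] : 1 - a * u n <= f (1 - u n) <= 1 - a * u n + C * u n ^+ 2.
    by apply: hC; rewrite ltW.
  by rewrite ler_pdivlMr // ler_pdivrMr //=; apply/andP; split; rewrite ?/cst; lra.
- rewrite -[X in _ --> X]subr0 -(mulr0 C).
  by apply: cvgB; [exact: cvg_cst | apply: cvgM => //; exact: cvg_cst].
- exact: cvg_cst.
Unshelve. all: by end_near. Qed.

(** Along the iterates of f, the increments of phi divided by those of the
identity converge to the left-hand side of the conclusion, and
[drift_limit_le0], used for x = 1 - phi and for its opposite, shows that this
limit vanishes.  Differentiability of phi at 1 would make this a plain
derivation, but it may fail for a law phi of infinite mean. *)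
Lemma functional_equation_drift p q c mu nu f g h phi :
  0 < p < 1 -> 0 < q ->
  expands_at_1 1 f ->
  (forall u : R, 0 <= u <= 1 -> 1 - u + q * u ^+ 2 <= f (1 - u)) ->
  expands_at_1 mu g -> expands_at_1 nu h ->
  (forall u : R^nat, (forall n, 0 < u n <= 1) -> u @ \oo --> 0 ->
     (fun n => phi (1 - u n)) @ \oo --> (1:R)) ->
  (forall s, 0 <= s <= 1 ->
     (f s - p) * phi s + h s * (1 - p) * f s * c =
     (f s - p) * c + h s * (1 - p) * f s * (phi (f s) * g (f s))) ->
  (1 - c) * (nu - p / (1 - p)) + mu = 0.
Proof.
move=> /andP[p0 p1] q0 Ef hq Eg Eh cphi Efun.
have [C [C0 hC]] := Ef.
pose next (u : R) : R := 1 - f (1 - u).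
(* Starting below 1 / C keeps the lower bound u - C u^2 positive. *)
pose u n : R := iter n next (C + 1)^-1.
have C1 : 0 < C + 1 by lra.
have uS n : u n.+1 = 1 - f (1 - u n) by [].
have u0P : 0 < u 0%N <= 1.
  by rewrite /u /= invr_gt0 C1 invf_le1 //; lra.
have Cu0 : C * u 0%N < 1.
  by rewrite /u /= ltr_pdivrMr //; lra.
have uP n : 0 < u n <= u 0%N.
  elim: n => [|n /andP[n0 n1]]; first by rewrite lexx andbT; case/andP: u0P.
  have un1 : u n <= 1 by case/andP: u0P => _; apply: le_trans.
  have hn : 0 <= u n <= 1 by rewrite ltW.
  have /andP[_] := hC _ hn; rewrite mul1r => h1.
  have h2 := hq _ hn.
  rewrite uS; apply/andP; split.
    have : C * u n < 1 by apply: le_lt_trans Cu0; rewrite ler_wpM2l.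
    nra.
  apply: le_trans n1; have : 0 <= q * u n ^+ 2 by rewrite mulr_ge0 ?sqr_ge0 // ltW.
  lra.
have u01 n : 0 < u n <= 1.
  have /andP[-> hun] := uP n; case/andP: u0P => _; exact: le_trans.
have u01' n : 0 <= u n <= 1 by have /andP[/ltW -> ->] := u01 n.
have hlo n : u n - C * u n ^+ 2 <= u n.+1.
  by have /andP[_] := hC _ (u01' n); rewrite uS mul1r => h1; lra.
have hup n : u n.+1 <= u n - q * u n ^+ 2.
  by have := hq _ (u01' n); rewrite uS => h1; lra.
have dec n : u n.+1 <= u n.
  by apply: (le_trans (hup n)); rewrite gerBl mulr_ge0 ?sqr_ge0 // ltW.
have cu : u @ \oo --> (0 : R).
  by apply: (quadratic_decay_cvg0 q0) => // n; have /andP[/ltW] := u01 n.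
have cu' : (fun n => u n.+1) @ \oo --> (0 : R) by rewrite (cvg_shiftS u).
pose x n := 1 - phi (1 - u n).
have cx : x @ \oo --> (0 : R).
  rewrite -(subrr (1 : R)); apply: cvgB; first exact: cvg_cst.
  exact: cphi.
have cx' : (fun n => x n.+1) @ \oo --> (0 : R) by rewrite (cvg_shiftS x).
(* t, eta and gam are difference quotients, with limits 1, nu and mu. *)
pose t n := (1 - f (1 - u n)) / u n.
pose eta n := (1 - h (1 - u n)) / u n.
pose gam n := (1 - g (1 - u n.+1)) / u n.+1.
have ct : t @ \oo --> (1 : R) by exact: expands_at_1_slope.
have ceta : eta @ \oo --> nu by exact: expands_at_1_slope.
have cgam : gam @ \oo --> mu.
  by apply: (@expands_at_1_slope _ _ (fun n => u n.+1)).
have p1' : 1 - p != 0 by lra.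
pose D n := (1 - c - x n.+1) * (eta n + t n - eta n * u n.+1)
   + (1 - u n * eta n) * (1 - u n.+1) * (t n * gam n) * (1 - x n.+1)
   - t n * (1 - c - x n) / (1 - p).
have DE : (fun n => (x n - x n.+1) / u n) = D.
  apply/funext => n; have /andP[un0 un1] := u01 n.
  have /andP[vn0 vn1] := u01 n.+1.
  have un : u n != 0 by rewrite gt_eqF.
  have vn : u n.+1 != 0 by rewrite gt_eqF.
  have fE : f (1 - u n) = 1 - u n.+1 by rewrite uS; ring.
  have := Efun (1 - u n); rewrite fE.
  have -> : phi (1 - u n) = 1 - x n by rewrite /x; ring.
  have -> : phi (1 - u n.+1) = 1 - x n.+1 by rewrite /x; ring.
  have -> : h (1 - u n) = 1 - u n * eta n by rewrite /eta; field.
  have -> : g (1 - u n.+1) = 1 - u n * t n * gam n.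
    by rewrite /gam /t -uS; field; apply/andP.
  have vE : u n.+1 = u n * t n by rewrite /t -uS; field.
  have h01 : 0 <= 1 - u n <= 1 by apply/andP; split; lra.
  move=> /(_ h01) E.
  rewrite /D vE in E *.
  apply: (mulIf un); rewrite mulfVK //; apply: (mulIf p1').
  transitivity (u n * (1 - p) *
   ((1 - c - x n.+1) * (eta n + t n - eta n * (u n * t n))
   + (1 - u n * eta n) * (1 - u n * t n) * (t n * gam n) * (1 - x n.+1))
    - u n * t n * (1 - c - x n)); last by field.
  lra.
have cD : D @ \oo --> (1 - c) * (nu - p / (1 - p)) + mu.
  have -> : (1 - c) * (nu - p / (1 - p)) + mu =
     (1 - c - 0) * (nu + 1 - nu * 0) + (1 - 0 * nu) * (1 - 0) * (1 * mu) * (1 - 0)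
       - 1 * (1 - c - 0) / (1 - p) by field.
  have cc (a : R) : (fun _ : nat => a) @ \oo --> a by exact: cvg_cst.
  rewrite /D.
  apply: cvgB; last first.
    apply: cvgM (cc _); exact: (cvgM ct (cvgB (cc _) cx)).
  apply: cvgD.
    exact: (cvgM (cvgB (cc _) cx') (cvgB (cvgD ceta ct) (cvgM ceta cu'))).
  apply: cvgM (cvgB (cc _) cx'); apply: cvgM (cvgM ct cgam).
  exact: (cvgM (cvgB (cc _) (cvgM cu ceta)) (cvgB (cc _) cu')).
rewrite -DE in cD.
have upos n : 0 < u n by have /andP[] := u01 n.
apply/eqP; rewrite eq_le; apply/andP; split.
  exact: (drift_limit_le0 C0 upos cu dec hlo cx cD).
have cNx : (fun n => - x n) @ \oo --> (0 : R) by rewrite -oppr0; exact: cvgN.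
rewrite -oppr_le0.
apply: (drift_limit_le0 C0 upos cu dec hlo cNx).
rewrite (_ : (fun n => _) = (fun n => - ((x n - x n.+1) / u n))).
  exact: cvgN.
by apply/funext => n; rewrite -mulNr; congr (_ / _); ring.
Qed.

End FunctionalEquation.

(** * Integrals of functions of discrete random variables *)

Section DiscreteIntegrals.
Local Open Scope ereal_scope.
Context d (T : measurableType d) (R : realType).

Lemma measurable_nat d' (T' : measurableType d') (F : nat -> T') :
  measurable_fun setT F.
Proof. by move=> _ A _. Qed.

Lemma measurable_comp_nat d' (T' : measurableType d') (F : nat -> T')
  (Z : T -> nat) : measurable_fun setT Z -> measurable_fun setT (F \o Z).
Proof. by move=> mZ; apply: measurableT_comp => //; exact: measurable_nat. Qed.

Lemma measurable_random_index (Z : T -> nat) (G : nat -> T -> nat) :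
  measurable_fun setT Z -> (forall n, measurable_fun setT (G n)) ->
  measurable_fun setT (fun w => G (Z w) w).
Proof.
move=> mZ mG _ A _; rewrite setTI.
have -> : (fun w => G (Z w) w) @^-1` A =
    \bigcup_n (Z @^-1` [set n] `&` (G n) @^-1` A).
  apply/seteqP; split => [w Aw|w [n _ [/= ->]] //]; first by exists (Z w).
apply: bigcupT_measurable => n; apply: measurableI.
- by rewrite -[X in measurable X]setTI; exact: mZ.
- by rewrite -[X in measurable X]setTI; exact: mG.
Qed.

(** The factor may be infinite: the series is an integral for the counting
measure. *)
Lemma nneseriesZl_ereal (c : \bar R) (a : nat -> \bar R) :
  0 <= c -> (forall k, 0 <= a k) ->
  \sum_(0 <= k <oo) (c * a k) = c * \sum_(0 <= k <oo) a k.
Proof.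
move=> c0 a0; rewrite -!ge0_integral_count //; last first.
  by move=> k; rewrite mule_ge0.
by rewrite ge0_integralZl.
Qed.

(** The weight W is what remains of a product after one factor F(Z) has been
conditioned upon. *)
Lemma integral_partition (mu : {measure set T -> \bar R}) (Z : T -> nat)
    (F : nat -> \bar R) (W : T -> \bar R) :
  measurable_fun setT Z -> measurable_fun setT W ->
  (forall k, 0 <= F k) -> (forall w, 0 <= W w) ->
  \int[mu]_w (F (Z w) * W w) =
  \sum_(0 <= k <oo) F k * \int[mu]_w (((Z w == k)%:R)%:E * W w).
Proof.
move=> mZ mW F0 W0.
have mG k : measurable_fun setT (fun w => ((Z w == k)%:R : R)%:E * W w).
  apply: emeasurable_funM => //.
  exact: (measurable_comp_nat (fun j => ((j == k)%:R : R)%:E)).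
have G0 k w : 0 <= ((Z w == k)%:R : R)%:E * W w by rewrite mule_ge0 ?lee_fin.
transitivity (\int[mu]_w \sum_(0 <= k <oo) (F k * (((Z w == k)%:R : R)%:E * W w))).
  apply: eq_integral => w _.
  rewrite (nneseriesD1 (n := Z w)) //=; last by move=> k _; rewrite mule_ge0.
  rewrite eqxx mul1e eseries0 ?adde0 // => k _ /= kZ.
  by rewrite eq_sym (negbTE kZ) mul0e mule0.
rewrite integral_nneseries //; last 2 first.
- by move=> k; exact: measurable_funeM.
- by move=> k w _; rewrite mule_ge0.
by apply: eq_eseriesr => k _; rewrite ge0_integralZl.
Qed.

Lemma integral_eq_indicator (mu : {measure set T -> \bar R}) (Z : T -> nat) k :
  measurable_fun setT Z ->
  \int[mu]_w ((Z w == k)%:R : R)%:E = mu [set w | Z w = k].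
Proof.
move=> mZ; transitivity (\int[mu]_w (\1_([set w | Z w = k]) w)%:E).
  apply: eq_integral => w _; rewrite indicE; congr ((_ : bool)%:R%:E).
  by apply/eqP/idP; rewrite inE.
rewrite integral_indic ?setIT //.
by rewrite -[X in measurable X]setTI; exact: (mZ measurableT [set k]).
Qed.

Lemma integral_law (mu : {measure set T -> \bar R}) (Z : T -> nat)
    (F : nat -> \bar R) :
  measurable_fun setT Z -> (forall k, 0 <= F k) ->
  \int[mu]_w F (Z w) = \sum_(0 <= k <oo) F k * mu [set w | Z w = k].
Proof.
move=> mZ F0.
transitivity (\int[mu]_w (F (Z w) * cst 1 w)).
  by apply: eq_integral => w _; rewrite mule1.
rewrite (integral_partition _ mZ) //; apply: eq_eseriesr => k _; congr (_ * _).
rewrite -(integral_eq_indicator _ _ mZ).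
by apply: eq_integral => w _; rewrite mule1.
Qed.

(** Independence is given on events.  The factors are replaced one at a time by
indicators: F(Z_a) is a sum of multiples of the indicators of [Z_a = k], so the
induction treats products of functions with the indicator of an event bearing
on other indices, and each step moves one index from the functions to the
event. *)
Lemma independent_prod (P : probability T R) (idx : eqType)
    (Z : idx -> T -> nat) :
  mutually_independent P Z -> (forall a, measurable_fun setT (Z a)) ->
  forall (s : seq idx) (F : idx -> nat -> \bar R), uniq s ->
  (forall a k, 0 <= F a k) ->
  \int[P]_w (\prod_(a <- s) F a (Z a w)) =
  \prod_(a <- s) \int[P]_w F a (Z a w).
Proof.
move=> indZ mZ s F us F0.
pose E (t : seq idx) (A : idx -> set nat) := \bigcap_(a in [set` t]) (Z a @^-1` A a).
have mE t A : measurable (E t A).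
  apply: fin_bigcap_measurable => [|a _]; first exact: finite_seq.
  by rewrite -[X in measurable X]setTI; exact: mZ.
have mF a : measurable_fun setT (fun w => F a (Z a w)).
  exact: (measurable_comp_nat (F a)).
have mprod t : measurable_fun setT (fun w => \prod_(a <- t) F a (Z a w)).
  elim: t => [|a t IH].
    by under eq_fun do rewrite big_nil; exact: measurable_cst.
  by under eq_fun do rewrite big_cons; exact: emeasurable_funM.
have prod0 t w : 0 <= \prod_(a <- t) F a (Z a w) by apply: prode_ge0.
(* s lists the factors still to be expanded, t those turned into events *)
suff : forall t A, uniq (s ++ t) ->
    \int[P]_w ((\prod_(a <- s) F a (Z a w)) * (\1_(E t A) w)%:E) =
    (\prod_(a <- s) \int[P]_w F a (Z a w)) * P (E t A).
  move=> /(_ [::] (fun=> setT)); rewrite cats0 => /(_ us).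
  have -> : E [::] (fun=> setT) = setT.
    by rewrite /E; apply/seteqP; split => // w _ a.
  rewrite probability_setT mule1 => <-.
  by apply: eq_integral => w _; rewrite indicT mule1.
elim: s {us} => [|a s IH] t A.
  move=> _; under eq_integral do rewrite big_nil mul1e.
  by rewrite big_nil mul1e integral_indic // setIT.
rewrite cat_cons /= => /andP[].
rewrite mem_cat negb_or => /andP[as_ at_] ust.
under eq_integral do rewrite big_cons -muleA.
pose A' k b := if b == a then [set k] else A b.
have PA' k : P (E (a :: t) (A' k)) = P [set w | Z a w = k] * P (E t A).
  rewrite /E !indZ ?big_cons.
  - rewrite /A' eqxx; congr (_ * _); apply: eq_big_seq => b bt.
    by case: eqP => // ba; rewrite -ba bt in at_.
  - by move: ust; rewrite cat_uniq => /and3P[].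
  - by rewrite /= at_; move: ust; rewrite cat_uniq => /and3P[].
have indE k w : (\1_(E (a :: t) (A' k)) w : R) =
    ((Z a w == k)%:R * \1_(E t A) w)%R.
  rewrite !indicE -natrM mulnb; congr ((_ : bool)%:R).
  apply/idP/andP => [/set_mem h|[/eqP h1 /set_mem h2]].
    split.
      have /h : a \in a :: t by rewrite mem_head.
      by rewrite /A' /= eqxx => ->.
    apply: mem_set => b /= bt; have /h : b \in a :: t by rewrite inE bt orbT.
    by rewrite /= /A'; case: eqP => // ba; rewrite -ba bt in at_.
  apply: mem_set => b /=; rewrite inE /A'.
  by case: eqP => [-> _ //|_ /= bt]; exact: h2.
rewrite integral_partition //; last 2 first.
- apply: emeasurable_funM => //; apply/measurable_EFinP.
  exact: measurable_indic.
- by move=> w; rewrite mule_ge0 // lee_fin.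
transitivity (\sum_(0 <= k <oo) (F a k * P [set w | Z a w = k]) *
    ((\prod_(b <- s) \int[P]_w F b (Z b w)) * P (E t A))).
  apply: eq_eseriesr => k _; rewrite -!muleA; congr (_ * _).
  rewrite muleCA -PA' -IH.
    apply: eq_integral => w _; rewrite indE EFinM; exact: muleCA.
  by rewrite -cat1s uniq_catCA /= mem_cat negb_or as_ at_ ust.
under eq_eseriesr do rewrite muleC.
rewrite nneseriesZl_ereal.
- by rewrite big_cons muleC muleA [in RHS]integral_law.
- by rewrite mule_ge0 // prode_ge0 // => b _; exact: integral_ge0.
- by move=> k; rewrite mule_ge0.
Qed.

End DiscreteIntegrals.

(** * One step of the chain *)

Section OneStep.
Context d (T : measurableType d) (R : realType) (P : probability T R).
Context (I_ J_ K_ : nat -> {RV P >-> nat}) (X_ : nat -> nat -> {RV P >-> nat})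
  (indep : mutually_independent P (innovation I_ J_ K_ X_)).

(** The term p^N is the mass of K >= N, on which the chain is reset to 0. *)
Lemma geometric_truncated_sum (p : R) (K : {RV P >-> nat}) (b : nat -> R) (N : nat) :
  0 < p < 1 -> geometric_law P p K -> (forall k, 0 <= b k) ->
  (\sum_(0 <= k <oo) (P [set w | K w = k] * (if (k < N)%N then b k else 1)%:E) =
   (p ^+ N + \sum_(k < N) (1 - p) * p ^+ k * b k)%:E)%E.
Proof.
move=> /andP[p0 p1] hK b0.
have PK0 k : 0 <= (1 - p) * p ^+ k by rewrite mulr_ge0 ?exprn_ge0 //; lra.
have split c : (forall k, 0 <= c k) ->
  (\sum_(0 <= k <oo) (P [set w | K w = k] * (if (k < N)%N then c k else 1)%:E) =
   (\sum_(k < N) (1 - p) * p ^+ k * c k)%:E +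
   \sum_(N <= k <oo) P [set w | K w = k])%E.
  move=> c0; rewrite (nneseries_split _ N); last first.
    by move=> k _; rewrite mule_ge0 // lee_fin; case: ifP.
  rewrite add0n; congr (_ + _)%E.
    rewrite -sumEFin big_mkord; apply: eq_bigr => k _.
    by rewrite hK ltn_ord.
  rewrite [LHS]eseries_cond [RHS]eseries_cond.
  apply: eq_eseriesr => k /=; rewrite leqNgt => /negbTE ->; exact: mule1.
have total : (\sum_(0 <= k <oo)
    (P [set w | K w = k] * (if (k < N)%N then 1 else 1)%:E))%E = 1%E.
  rewrite -(@probability_setT _ _ _ P) -[P setT]mul1e -integral_cst //.
  rewrite (integral_law P (Z := K) (F := fun=> 1%E)) //.
  by apply: eq_eseriesr => k _; rewrite if_same muleC.
have tail : (\sum_(N <= k <oo) P [set w | K w = k] = (p ^+ N)%:E)%E.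
  move: total; rewrite (split (fun=> 1)) //.
  have -> : \sum_(k < N) (1 - p) * p ^+ k * 1 = 1 - p ^+ N.
    elim: (N) => [|n IH]; first by rewrite big_ord0 expr0 subrr.
    by rewrite big_ord_recr /= IH exprS; ring.
  case: (\sum_(N <= k <oo) _)%E => [x| |] //= [h]; congr _%:E; lra.
by rewrite split // tail -EFinD addrC.
Qed.

Lemma measurable_branching1 (y : nat) :
  measurable_fun setT (branching I_ J_ K_ X_ (fun=> y) 1).
Proof.
apply: (measurable_random_index (Z := I_ 0%N) (G := fun i w =>
  if (K_ 0%N w < y + i)%N then
    (J_ 0%N w + \sum_(m < y + i - K_ 0%N w) X_ m 0%N w)%N else 0%N)) => // i.
apply: (measurable_random_index (Z := K_ 0%N) (G := fun k w =>
  if (k < y + i)%N then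
    (J_ 0%N w + \sum_(m < y + i - k) X_ m 0%N w)%N else 0%N)) => // k.
case: (k < y + i)%N; last exact: measurable_cst.
apply: (measurable_random_index (Z := J_ 0%N) (G := fun j w =>
  (j + \sum_(m < y + i - k) X_ m 0%N w)%N)) => // j.
apply: (measurable_comp_nat (addn j)).
elim: (y + i - k)%N => [|n IH].
  by under eq_fun do rewrite big_ord0; exact: measurable_cst.
under eq_fun do rewrite big_ord_recr /=.
apply: (measurable_random_index (Z := X_ n 0%N) (G := fun x w =>
  (\sum_(m < n) X_ m 0%N w + x)%N)) => // x.
exact: (measurable_comp_nat (addn^~ x)).
Qed.

(** Condition on I = i and K = k.  If k < y + i, the next state is a sum of J and
of y + i - k copies of X, with generating function h r^(y + i - k); otherwise it
is 0.  The sum over k is then [geometric_truncated_sum]. *)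
Lemma one_step_pgf (p s h r : R) (y : nat) :
  0 < p < 1 -> geometric_law P p (K_ 0%N) -> 0 <= s -> 0 <= h -> 0 <= r ->
  (\int[P]_w (s ^+ J_ 0%N w)%:E = h%:E)%E ->
  (forall m, \int[P]_w (s ^+ X_ m 0%N w)%:E = r%:E)%E ->
  (\int[P]_w (s ^+ branching I_ J_ K_ X_ (fun=> y) 1 w)%:E =
   \int[P]_w (p ^+ (y + I_ 0%N w) +
     \sum_(k < y + I_ 0%N w) (1 - p) * p ^+ k * (h * r ^+ (y + I_ 0%N w - k)))%:E)%E.
Proof.
move=> hp hK s0 h0 r0 hJ hX; have /andP[p0 p1] := hp.
pose Y := branching I_ J_ K_ X_ (fun=> y) 1.
have mZ a : measurable_fun setT (innovation I_ J_ K_ X_ a).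
  by case: a => [[[n|n]|n]|[m n]] /=.
have mY : measurable_fun setT (fun w => (s ^+ Y w)%:E).
  exact: (measurable_comp_nat (fun n => (s ^+ n)%:E) (measurable_branching1 y)).
have mI : measurable_fun setT (I_ 0%N) by [].
have mK : measurable_fun setT (K_ 0%N) by [].
pose B i k := if (k < y + i)%N then h * r ^+ (y + i - k) else 1.
have B0 i k : 0 <= B i k by rewrite /B; case: ifP => // _; rewrite mulr_ge0 ?exprn_ge0.
have key i k : (\int[P]_w (((K_ 0%N w == k)%:R)%:E *
     (((I_ 0%N w == i)%:R)%:E * (s ^+ Y w)%:E)) =
   P [set w | I_ 0%N w = i] * (P [set w | K_ 0%N w = k] * (B i k)%:E))%E.
  (* The factors: indicators of I = i and K = k, powers of s for J and the X. *)
  pose F (a : nat + nat + nat + nat * nat) (n : nat) : \bar R :=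
    match a with
    | inl (inl (inl _)) => ((n == i)%:R)%:E
    | inl (inr _) => ((n == k)%:R)%:E
    | _ => (s ^+ n)%:E
    end.
  have F0 a n : (0 <= F a n)%E.
    by case: a => [[[?|?]|?]|[? ?]]; rewrite lee_fin ?exprn_ge0.
  pose aI : nat + nat + nat + nat * nat := inl (inl (inl 0%N)).
  pose aK : nat + nat + nat + nat * nat := inl (inr 0%N).
  pose aJ : nat + nat + nat + nat * nat := inl (inl (inr 0%N)).
  pose aX m : nat + nat + nat + nat * nat := inr (m, 0%N).
  pose l := [:: aI, aK & if (k < y + i)%N then
    aJ :: [seq aX m | m <- index_iota 0 (y + i - k)] else [::]].
  have ul : uniq l.
    rewrite /l; case: ifP => _ //=.
    rewrite !inE /= map_inj_uniq ?iota_uniq ?andbT; last by move=> m1 m2 [].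
    by apply/and3P; split; apply/mapP => -[].
  transitivity (\int[P]_w (\prod_(a <- l) F a (innovation I_ J_ K_ X_ a w)))%E.
    apply: eq_integral => w _; rewrite /l 2!big_cons /= muleCA.
    case: (I_ 0%N w =P i) => [iw|_]; last by rewrite !mul0e.
    case: (K_ 0%N w =P k) => [kw|_]; last by rewrite !mul0e.
    rewrite !mul1e /Y /= kw iw; case: ifP => _; last by rewrite big_nil expr0.
    rewrite big_cons big_map /= big_mkord exprD EFinM; congr (_ * _)%E.
    by rewrite expr_sum prodEFin.
  rewrite independent_prod // /l !big_cons /= !integral_eq_indicator //.
  congr (_ * (_ * _))%E; rewrite /B.
  case: ifP => _; last by rewrite big_nil.
  rewrite big_cons big_map big_mkord /= hJ; under eq_bigr do rewrite hX.
  by rewrite prodEFin prodr_const card_ord.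
transitivity (\int[P]_w (cst 1 (I_ 0%N w) * (s ^+ Y w)%:E))%E.
  by apply: eq_integral => w _; rewrite mul1e.
rewrite integral_partition //; last by move=> w; rewrite lee_fin exprn_ge0.
rewrite (integral_law P (Z := I_ 0%N) (F := fun i => (p ^+ (y + i) +
     \sum_(k < y + i) (1 - p) * p ^+ k * (h * r ^+ (y + i - k)))%:E)%E) //; last first.
  move=> i; rewrite lee_fin addr_ge0 ?exprn_ge0 ?sumr_ge0 // ?ltW // => k _.
  by rewrite !mulr_ge0 ?exprn_ge0 // ?subr_ge0 ltW.
apply: eq_eseriesr => i _; rewrite mul1e.
transitivity (\int[P]_w (cst 1 (K_ 0%N w) * (((I_ 0%N w == i)%:R)%:E * (s ^+ Y w)%:E)))%E.
  by apply: eq_integral => w _; rewrite mul1e.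
rewrite integral_partition //; last 2 first.
- apply: emeasurable_funM => //.
  exact: (measurable_comp_nat (fun n => ((n == i)%:R : R)%:E)).
- by move=> w; rewrite mule_ge0 // lee_fin // exprn_ge0.
under eq_eseriesr do rewrite mul1e key.
rewrite nneseriesZl_ereal //; last by move=> k; rewrite mule_ge0 // lee_fin.
rewrite muleC (geometric_truncated_sum _ hp hK) // => k.
by rewrite mulr_ge0 ?exprn_ge0.
Qed.

End OneStep.

(** * Generating functions and moments of laws on the natural numbers *)

Section GeneratingFunctions.
Context (R : realType).
Implicit Types (m : probability nat R).

Lemma integral_cst_probability m (c : R) : (\int[m]_k (cst c%:E k) = c%:E)%E.
Proof.
by rewrite integral_cst // -[RHS]mule1; congr (_ * _)%E; exact: probability_setT.
Qed.

Definition pgf m (s : R) : R := fine (\int[m]_k (s ^+ k)%:E)%E.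

Lemma integral_exprn_le1 m (s : R) : 0 <= s <= 1 ->
  (\int[m]_k (s ^+ k)%:E <= 1)%E.
Proof.
move=> /andP[s0 s1]; rewrite -(integral_cst_probability m 1).
apply: ge0_le_integral => // k _; rewrite lee_fin ?exprn_ge0 //.
exact: exprn_ile1.
Qed.

Lemma pgfE m (s : R) : 0 <= s <= 1 ->
  (\int[m]_k (s ^+ k)%:E = (pgf m s)%:E)%E.
Proof.
move=> /[dup] s01 /andP[s0 s1]; rewrite fineK // ge0_fin_numE; last first.
  by apply: integral_ge0 => k _; rewrite lee_fin exprn_ge0.
exact: le_lt_trans (integral_exprn_le1 m s01) (ltry _).
Qed.

Lemma pgf_ge0 m (s : R) : 0 <= s -> 0 <= pgf m s.
Proof.
by move=> s0; apply/fine_ge0/integral_ge0 => k _; rewrite lee_fin exprn_ge0.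
Qed.

Lemma pgf_le1 m (s : R) : 0 <= s <= 1 -> pgf m s <= 1.
Proof. by move=> s01; rewrite -lee_fin -pgfE //; exact: integral_exprn_le1. Qed.

(** Bernoulli's inequality with a second-order gain for exponents at least 2:
it is what makes the generating function strictly convex at 1. *)
Lemma exprB1_convex_ge (u : R) (k : nat) : 0 <= u <= 1 -> 
  1 + (2 <= k)%N%:R * u ^+ 2 <= (1 - u) ^+ k + k%:R * u.
Proof.
move=> /andP[u0 u1].
have w01 n : 0 <= (1 - u) ^+ n <= 1 by rewrite exprn_ge0 ?exprn_ile1 //; lra.
case: k => [|[|k]]; first by rewrite expr0 !mul0r.
  by rewrite expr1 mul0r mul1r; lra.
have -> : (2 <= k.+2)%N by [].
rewrite mul1r; elim: k => [|k IH]; first by rewrite !expr2; lra.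
apply: le_trans IH _; have /andP[_ h] := w01 k.+2.
rewrite [(1 - u) ^+ k.+3]exprS -[k.+3]addn1 natrD.
by nra.
Qed.

Lemma exprB1_convex_le (u : R) (k : nat) : 0 <= u <= 1 -> 
  (1 - u) ^+ k + k%:R * u <= 1 + k%:R ^+ 2 * u ^+ 2.
Proof.
move=> /andP[u0 u1]; elim: k => [|k IH]; first by rewrite expr0 !mul0r expr0n /= mul0r.
have k0 : 0 <= k%:R :> R by [].
have : (1 - u) * (1 - u) ^+ k <= (1 - u) * (1 + k%:R ^+ 2 * u ^+ 2 - k%:R * u).
  by apply: ler_wpM2l; lra.
rewrite [(1 - u) ^+ k.+1]exprS -[k.+1]addn1 natrD => h.
have h1 : 0 <= k%:R * u ^+ 2 by rewrite mulr_ge0 ?sqr_ge0.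
have h2 : 0 <= (k%:R * u) ^+ 2 * u by rewrite mulr_ge0 ?sqr_ge0.
have h3 := sqr_ge0 u.
lra.
Qed.

Lemma integral_affine m (F : nat -> R) (c u : R) : (forall k, 0 <= F k) ->
   0 <= c -> 0 <= u ->
  (\int[m]_k (c + F k * u)%:E = c%:E + (\int[m]_k (F k)%:E) * u%:E)%E.
Proof.
move=> F0 c0 u0.
under eq_integral do rewrite EFinD mulrC EFinM.
rewrite ge0_integralD //; last by move=> k _; rewrite -EFinM lee_fin mulr_ge0.
rewrite -[X in (X + _)%E]/(\int[m]_k (cst c%:E k))%E integral_cst_probability.
congr (_ + _)%E.
rewrite ge0_integralZl_EFin // 1?muleC // => k _; exact: F0.
Qed.

Definition moment m (r : nat) : \bar R := (\int[m]_k (k%:R ^+ r)%:E)%E.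

Lemma moment_le m (r1 r2 : nat) : (0 < r1 <= r2)%N -> (moment m r1 <= moment m r2)%E.
Proof.
move=> /andP[r0 r12]; apply: ge0_le_integral => // k _; rewrite lee_fin ?exprn_ge0 //.
case: k => [|k]; first by rewrite !expr0n !gtn_eqF // (leq_trans r0).
by rewrite ler_weXn2l // ler1n.
Qed.

Lemma momentE m (r : nat) : (moment m r < +oo)%E ->
  moment m r = (fine (moment m r))%:E.
Proof.
move=> h; rewrite fineK // ge0_fin_numE //.
by apply: integral_ge0 => k _; rewrite lee_fin exprn_ge0.
Qed.

(** Adding the mean term turns the bounds on the generating function into
comparisons of integrals of nonnegative functions. *)
Lemma pgf_add_mean m (u : R) : 0 <= u <= 1 -> (moment m 1 < +oo)%E ->
  (\int[m]_k ((1 - u) ^+ k + k%:R * u)%:E =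
   (pgf m (1 - u) + fine (moment m 1) * u)%:E)%E.
Proof.
move=> /andP[u0 u1] m1; under eq_integral do rewrite EFinD mulrC EFinM.
have w0 : 0 <= 1 - u by lra.
rewrite ge0_integralD //; last 2 first.
- by move=> k _; rewrite lee_fin exprn_ge0.
- by move=> k _; rewrite -EFinM lee_fin mulr_ge0.
rewrite ge0_integralZl_EFin // pgfE; last by apply/andP; split; lra.
by rewrite -[X in (_ + _ * X)%E]/(moment m 1) momentE // EFinD EFinM [(u%:E * _)%E]muleC.
Qed.

Lemma pgf_expands m : (moment m 2 < +oo)%E -> expands_at_1 (fine (moment m 1)) (pgf m).
Proof.
move=> m2; have m1 : (moment m 1 < +oo)%E by apply: le_lt_trans m2; exact: moment_le.
exists (fine (moment m 2)); split.
  by apply/fine_ge0/integral_ge0 => k _; rewrite lee_fin exprn_ge0.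
move=> u /[dup] u01 /andP[u0 u1]; have w0 : 0 <= 1 - u by lra.
have h := pgf_add_mean u01 m1.
suff : 1 <= pgf m (1 - u) + fine (moment m 1) * u <= 1 + fine (moment m 2) * u ^+ 2.
  by move=> /andP[h1 h2]; apply/andP; split; lra.
rewrite -!lee_fin -h; apply/andP; split.
  rewrite -(integral_cst_probability m 1); apply: ge0_le_integral => //= k _.
  rewrite lee_fin; apply: le_trans (exprB1_convex_ge k u01).
  by rewrite lerDl mulr_ge0 ?sqr_ge0.
rewrite EFinD EFinM -momentE // -integral_affine ?sqr_ge0 //.
apply: ge0_le_integral => //= k _.
- by rewrite lee_fin addr_ge0 ?mulr_ge0 ?exprn_ge0.
- by rewrite lee_fin; exact: exprB1_convex_le.
Qed.

Lemma pgf_curvature m (u : R) : (moment m 1 < +oo)%E -> 0 <= u <= 1 ->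
  1 - fine (moment m 1) * u + fine (m [set k | (2 <= k)%N]) * u ^+ 2
    <= pgf m (1 - u).
Proof.
move=> m1 /[dup] u01 /andP[u0 u1]; have w0 : 0 <= 1 - u by lra.
suff : 1 + fine (m [set k | (2 <= k)%N]) * u ^+ 2 <=
  pgf m (1 - u) + fine (moment m 1) * u by lra.
have -> : fine (m [set k | (2 <= k)%N]) =
    fine (\int[m]_k (\1_[set k | (2 <= k)%N] k)%:E)%E.
  by rewrite integral_indic // setIT.
rewrite -lee_fin -pgf_add_mean // EFinD EFinM fineK; last first.
  by rewrite integral_indic // fin_num_measure.
rewrite -integral_affine ?sqr_ge0 //.
apply: ge0_le_integral => //= k _.
- by rewrite lee_fin addr_ge0 ?mulr_ge0 ?sqr_ge0.
- rewrite lee_fin; apply: le_trans (exprB1_convex_ge k u01).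
  rewrite indicE; set a := _ \in _; set b := (_ <= _)%N.
  by have -> : a = b by apply/idP/idP; rewrite /a inE.
Qed.

Lemma pgf_cvg1 m (u : R^nat) : (forall n, 0 < u n <= 1) -> u @ \oo --> 0 ->
  (fun n => pgf m (1 - u n)) @ \oo --> (1 : R).
Proof.
move=> u01 cu.
have iP : m.-integrable setT (EFin \o cst (1 : R)).
  exact: finite_measure_integrable_cst.
have w01 n : 0 <= 1 - u n <= 1 by have /andP[h1 h2] := u01 n; apply/andP; split; lra.
have : (fun n => \int[m]_k (((1 - u n) ^+ k)%:E))%E @ \oo --> (\int[m]_k (cst 1%:E k))%E.
  apply: (@dominated_cvg _ _ _ m setT measurableT _ _ (cst 1%:E)) => //.
  - move=> k _; apply: cvg_EFin; first by near=> n.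
    rewrite -[X in _ --> X](expr1n _ k); elim: k => [|k IH].
      by under eq_fun do rewrite expr0; exact: cvg_cst.
    under eq_fun do rewrite exprS; rewrite exprS; apply: cvgM => //.
    rewrite -[X in _ --> X]subr0; apply: cvgB => //; exact: cvg_cst.
  - move=> n k _; rewrite lee_fin ger0_norm ?exprn_ge0 //; last by case/andP: (w01 n).
    by case/andP: (w01 n) => ? ?; rewrite exprn_ile1.
rewrite integral_cst_probability; under eq_fun do rewrite pgfE //.
by move/fine_cvgP => [].
Unshelve. all: by end_near. Qed.

End GeneratingFunctions.

(** * Laws of the innovations *)

Section Laws.
Context d (T : measurableType d) (R : realType) (P : probability T R).
Implicit Types Z : {RV P >-> nat}.

Lemma same_law_integral Z Z' (F : nat -> R) : same_law Z Z' ->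
  (forall k, 0 <= F k) ->
  (\int[P]_w (F (Z w))%:E = \int[distribution P Z']_k (F k)%:E)%E.
Proof.
move=> ZZ' F0; rewrite -(ge0_integral_distribution Z (f := EFin \o F)) //.
by apply: eq_measure_integral => A _ _; exact: ZZ'.
Qed.

Lemma expectation_natR_exp Z (n : nat) :
  ('E_P[natR R Z ^+ n] = moment (distribution P Z) n)%E.
Proof.
rewrite unlock /moment -(@same_law_integral Z Z (fun k => k%:R ^+ n)) //.
by apply: eq_integral => w _; rewrite exprfctE.
Qed.

Lemma expectation_natR Z : ('E_P[natR R Z] = moment (distribution P Z) 1)%E.
Proof. by rewrite -expectation_natR_exp expr1. Qed.

(** The partial sums of k (1 - p) p^k satisfy S_(n+1) = p S_n + p (1 - p^n); this
bounds them, and determines their limit as the fixed point of S = p S + p. *)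
Lemma geometric_mean (p : R) Z : 0 < p < 1 -> geometric_law P p Z ->
  mean P Z = p / (1 - p).
Proof.
move=> /andP[p0 p1] hZ.
have p1' : 1 - p != 0 by lra.
rewrite /mean unlock.
rewrite (integral_law P (Z := Z) (F := fun k => (k%:R)%:E)) //.
pose a k := k%:R * ((1 - p) * p ^+ k).
pose S n := \sum_(0 <= k < n) a k.
have a0 k : 0 <= a k by rewrite !mulr_ge0 ?exprn_ge0 ?subr_ge0 // ltW.
have SS n : S n.+1 = p * S n + p * (1 - p ^+ n).
  elim: n => [|n IH].
    by rewrite /S big_nat1 big_geq // /a expr0; ring.
  rewrite {1}/S big_nat_recr //= -/(S _) {1}IH /S big_nat_recr //= -/(S _).
  by rewrite /a -[n.+1%:R]natr1 exprS; ring.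
have Sle n : S n <= p / (1 - p).
  elim: n => [|n IH].
    by rewrite /S big_geq // divr_ge0 ?subr_ge0 // ltW.
  rewrite SS; have pn : 0 <= p ^+ n by rewrite exprn_ge0 // ltW.
  have -> : p / (1 - p) = p * (p / (1 - p)) + p by field.
  by rewrite lerD ?ler_pM2l // ger_pMr // gerBl.
have cS : cvgn S.
  apply: nondecreasing_is_cvgn.
    by apply/nondecreasing_seqP => n; rewrite /S big_nat_recr //= lerDl.
  by exists (p / (1 - p)) => _ [n _ <-].
have cS' : (fun n => S n.+1) @ \oo --> limn S by rewrite (cvg_shiftS S).
have cS2 : (fun n => S n.+1) @ \oo --> p * limn S + p * (1 - 0).
  under eq_fun do rewrite SS.
  apply: cvgD; first by apply: cvgM => //; exact: cvg_cst.
  apply: cvgM; first exact: cvg_cst.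
  apply: cvgB; first exact: cvg_cst.
  rewrite exprn_geometric; apply: cvg_geometric.
  by rewrite ger0_norm // ltW.
have LE : limn S = p / (1 - p).
  have : limn S = p * limn S + p * (1 - 0).
    by rewrite -{1}(cvg_lim _ cS') // (cvg_lim _ cS2).
  rewrite subr0 mulr1 => L; apply: (mulIf p1'); rewrite mulfVK //; lra.
rewrite -LE -[RHS]/(fine (limn S)%:E) -EFin_lim //; congr (fine (limn _)).
apply/funext => n; rewrite /S /= -sumEFin; apply: eq_bigr => k _.
by rewrite hZ EFinM.
Qed.

End Laws.

(** A law on {0, 1} of mean 1 is the point mass at 1, which has variance 0. *)
Lemma nondegenerate_mass_ge2 (R : realType) (m : probability nat R) :
  moment m 1 = 1%E -> (0 < \int[m]_k ((k%:R - 1) ^+ 2)%:E)%E ->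
  0 < fine (m [set k | (2 <= k)%N]).
Proof.
move=> m1 mV; rewrite lt_neqAle fine_ge0 // andbT eq_sym.
apply/negP => /eqP m2.
have mk k : (2 <= k)%N -> m [set k] = 0%E.
  move=> k2; apply/eqP; rewrite -measure_le0.
  have -> : 0%E = m [set k | (2 <= k)%N] by rewrite -[RHS]fineK ?fin_num_measure // m2.
  by apply: le_measure; rewrite ?inE // => _ ->.
have intE (F : nat -> R) : (forall k, 0 <= F k) ->
  (\int[m]_k (F k)%:E = (F 0%N)%:E * m [set 0%N] + (F 1%N)%:E * m [set 1%N])%E.
  move=> F0; rewrite (integral_law m (Z := id) (F := EFin \o F)) //.
  rewrite (nneseries_split _ 2) ?add0n; last by move=> k _; rewrite mule_ge0 // lee_fin.
  rewrite big_nat_recr //= big_nat1 eseries0 ?adde0 // => k k2 _.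
  by rewrite -[[set w | _]]/[set k] mk // mule0.
have e1 : m [set 1%N] = 1%E.
  by rewrite -m1 /moment intE ?mul0e ?add0e ?mul1e // => k; rewrite exprn_ge0.
have e0 : m [set 0%N] = 0%E.
  have := integral_cst_probability m 1; rewrite (intE (fun=> 1)) // !mul1e e1.
  by case: (m [set 0%N]) => [x| |] //= [] h; congr _%:E; lra.
have : (\int[m]_k ((k%:R - 1) ^+ 2)%:E = 0)%E.
  rewrite intE => [|k]; last exact: sqr_ge0.
  by rewrite e0 mule0 subrr expr0n mul0e adde0.
by move=> h; rewrite h ltxx in mV.
Qed.

(** * The functional equation of a stationary law *)

Section StationaryEquation.
Context d (T : measurableType d) (R : realType) (P : probability T R).
Context (I_ J_ K_ : nat -> {RV P >-> nat}) (X_ : nat -> nat -> {RV P >-> nat})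
  (I J X : {RV P >-> nat}) (p : R) (pi : probability nat R)
  (indep : mutually_independent P (innovation I_ J_ K_ X_))
  (hp : 0 < p < 1) (hK : geometric_law P p (K_ 0%N))
  (hI : same_law (I_ 0%N) I) (hJ : same_law (J_ 0%N) J)
  (hX : forall m, same_law (X_ m 0%N) X)
  (hpi : stationary (trans_prob P I_ J_ K_ X_) pi).

Let phi := pgf pi.
Let f := pgf (distribution P X).
Let g := pgf (distribution P I).
Let h := pgf (distribution P J).

Lemma stationary_integral (F : nat -> R) : (forall k, 0 <= F k) ->
  (\int[pi]_z (F z)%:E =
   \int[pi]_y \int[P]_w (F (branching I_ J_ K_ X_ (fun=> y) 1 w))%:E)%E.
Proof.
move=> F0.
rewrite (integral_law pi (Z := id) (F := EFin \o F)) //.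
rewrite (integral_law pi (Z := id) (F := fun y =>
  \int[P]_w (F (branching I_ J_ K_ X_ (fun=> y) 1 w))%:E)%E) //; last first.
  by move=> y; apply: integral_ge0 => w _; rewrite lee_fin.
transitivity (\sum_(0 <= z <oo) \sum_(0 <= y <oo) ((F z)%:E *
    (pi [set y] * trans_prob P I_ J_ K_ X_ 1 y z)))%E.
  apply: eq_eseriesr => z _; rewrite nneseriesZl; first by rewrite -hpi.
  by move=> y _; rewrite mule_ge0 ?measure_ge0.
rewrite nneseries_interchange; last first.
  by move=> z y; rewrite !mule_ge0 ?lee_fin ?measure_ge0.
apply: eq_eseriesr => y _.
rewrite (integral_law P (F := EFin \o F) (measurable_branching1 I_ J_ K_ X_ y)) //.
rewrite muleC -nneseriesZl_ereal //; last first.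
  by move=> z; rewrite mule_ge0 ?lee_fin ?measure_ge0.
by apply: eq_eseriesr => z _; rewrite muleCA.
Qed.

(** The expectation of b(N), where N = Y + I with Y of law pi. *)
Let N_int (b : nat -> R) := (\int[pi]_y \int[distribution P I]_i (b (y + i)%N)%:E)%E.

Let inner0 (b : nat -> R) y : (forall k, 0 <= b k) ->
  (0 <= \int[distribution P I]_i (b (y + i)%N)%:E)%E.
Proof. by move=> b0; apply: integral_ge0 => i _; rewrite lee_fin. Qed.

Let N_intD (b1 b2 : nat -> R) : (forall k, 0 <= b1 k) -> (forall k, 0 <= b2 k) ->
  (N_int (fun k => b1 k + b2 k)%R = N_int b1 + N_int b2)%E.
Proof.
move=> b10 b20; rewrite /N_int -ge0_integralD //; last 2 first.
- by move=> y _; exact: inner0.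
- by move=> y _; exact: inner0.
apply: eq_integral => y _; rewrite -ge0_integralD //.
- by move=> i _; rewrite lee_fin.
- by move=> i _; rewrite lee_fin.
Qed.

Let N_intZ (c : R) (b : nat -> R) : 0 <= c -> (forall k, 0 <= b k) ->
  (N_int (fun k => c * b k)%R = c%:E * N_int b)%E.
Proof.
move=> c0 b0; rewrite /N_int -ge0_integralZl_EFin //; last first.
  by move=> y _; exact: inner0.
apply: eq_integral => y _; rewrite -ge0_integralZl_EFin // => i _.
by rewrite lee_fin.
Qed.

Let N_intX (s : R) : 0 <= s <= 1 -> N_int (fun k => s ^+ k) = (phi s * g s)%:E.
Proof.
move=> /[dup] s01 /andP[s0 s1].
transitivity (\int[pi]_y ((g s)%:E * (s ^+ y)%:E))%E.
  apply: eq_integral => y _; rewrite -pgfE // muleC -ge0_integralZl_EFin ?exprn_ge0 //.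
    by apply: eq_integral => i _; rewrite exprD EFinM.
  by move=> i _; rewrite lee_fin exprn_ge0.
rewrite ge0_integralZl_EFin ?pgf_ge0 //; last by move=> y _; rewrite lee_fin exprn_ge0.
by rewrite pgfE // -EFinM mulrC.
Qed.

(** The generating function at s of the next state, given N = k. *)
Let A s k := p ^+ k + \sum_(j < k) (1 - p) * p ^+ j * (h s * f s ^+ (k - j)).

Let N_intA s : 0 <= s <= 1 -> N_int (A s) = (phi s)%:E.
Proof.
move=> /[dup] s01 /andP[s0 s1]; have /andP[p0 p1] := hp.
rewrite -pgfE // stationary_integral; last by move=> k; rewrite exprn_ge0.
apply: eq_integral => y _.
rewrite (one_step_pgf (h := h s) (r := f s) indep y hp hK s0
  (pgf_ge0 _ s0) (pgf_ge0 _ s0)).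
- rewrite -(same_law_integral (F := fun i => A s (y + i)%N) hI) // => k.
  rewrite addr_ge0 ?exprn_ge0 ?sumr_ge0 // ?ltW // => j _.
  by rewrite !mulr_ge0 ?exprn_ge0 ?pgf_ge0 // ?subr_ge0 ltW.
- rewrite (same_law_integral (F := fun k => s ^+ k) hJ) ?pgfE // => k.
  exact: exprn_ge0.
- move=> m; rewrite (same_law_integral (F := fun k => s ^+ k) (hX m)) ?pgfE // => k.
  exact: exprn_ge0.
Qed.

(** Summing the geometric progression in A gives
(f - p) A(k) = (f - p) p^k + (1 - p) h f (f^k - p^k); the equation is the
expectation of this identity at k = N. *)
Lemma stationary_pgf s : 0 <= s <= 1 ->
  (f s - p) * phi s + h s * (1 - p) * f s * (phi p * g p) =
  (f s - p) * (phi p * g p) + h s * (1 - p) * f s * (phi (f s) * g (f s)).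
Proof.
move=> /[dup] s01 /andP[s0 s1]; have /andP[p0 p1] := hp.
have p01 : 0 <= p <= 1 by rewrite !ltW.
have r0 : 0 <= f s by exact: pgf_ge0.
have h0 : 0 <= h s by exact: pgf_ge0.
have r01 : 0 <= f s <= 1 by rewrite r0 pgf_le1.
have A0 k : 0 <= A s k.
  rewrite addr_ge0 ?exprn_ge0 ?sumr_ge0 // ?ltW // => j _.
  by rewrite !mulr_ge0 ?exprn_ge0 // ?subr_ge0 ltW.
have pX0 k : 0 <= p ^+ k by rewrite exprn_ge0 ?ltW.
have rX0 k : 0 <= f s ^+ k by rewrite exprn_ge0.
have c0 : 0 <= h s * (1 - p) * f s by rewrite !mulr_ge0 ?subr_ge0 // ltW.
(* All terms are moved to the side where they are nonnegative, so that
   expectations can be taken without integrability conditions. *)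
have AE k : f s * A s k + (h s * (1 - p) * f s + p) * p ^+ k =
    (f s * p ^+ k + p * A s k) + h s * (1 - p) * f s * f s ^+ k.
  suff : (f s - p) * A s k = (f s - p) * p ^+ k +
      h s * (1 - p) * f s * (f s ^+ k - p ^+ k) by lra.
  rewrite /A mulrDr; congr (_ + _); rewrite subrXX mulrCA [in RHS]mulrCA.
  rewrite !mulr_sumr; apply: eq_bigr => j _.
  have -> : (k - j)%N = (k.-1 - j).+1.
    by have := ltn_ord j; move: (nat_of_ord j) => i; case: (k) => // n /subSn.
  by rewrite exprS; ring.
have := N_intX p01; have := N_intX r01; have := N_intA s01.
move=> EA Er Ep.
have : N_int (fun k => f s * A s k + (h s * (1 - p) * f s + p) * p ^+ k) =
  N_int (fun k => (f s * p ^+ k + p * A s k) + h s * (1 - p) * f s * f s ^+ k).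
  by congr N_int; apply/funext.
have pge0 := ltW p0; have cp0 : 0 <= h s * (1 - p) * f s + p by rewrite addr_ge0.
have fA0 k : 0 <= f s * A s k by rewrite mulr_ge0.
have cpX0 k : 0 <= (h s * (1 - p) * f s + p) * p ^+ k by rewrite mulr_ge0.
have fX0 k : 0 <= f s * p ^+ k by rewrite mulr_ge0.
have pA0 k : 0 <= p * A s k by rewrite mulr_ge0.
have sum0 k : 0 <= f s * p ^+ k + p * A s k by rewrite addr_ge0.
have crX0 k : 0 <= h s * (1 - p) * f s * f s ^+ k by rewrite mulr_ge0.
rewrite !N_intD // !N_intZ // EA Er Ep -!EFinM -!EFinD => -[] E.
lra.
Qed.

(** At s = 0 both sides of stationarity are probabilities of the state 0: since
J > 0, the chain moves to 0 only if K >= N, which has probability E p^N. *)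
Lemma stationary_atom0 : P [set w | (0 < J w)%N] = 1%E ->
  pi [set 0%N] = (phi p * g p)%:E.
Proof.
move=> hJ0; have /andP[p0 p1] := hp.
have p01 : 0 <= p <= 1 by rewrite !ltW.
have z01 : 0 <= (0 : R) <= 1 by rewrite lexx ler01.
have pgf0 (m : probability nat R) : (pgf m 0)%:E = m [set 0%N].
  rewrite -pgfE // -[RHS](integral_eq_indicator m (Z := id) 0%N) //.
  by apply: eq_integral => k _; rewrite expr0n.
have h0 : h 0 = 0.
  apply: (@EFin_inj R); rewrite pgf0 -[LHS]/(P (J @^-1` [set 0%N])).
  have -> : J @^-1` [set 0%N] = ~` [set w | (0 < J w)%N].
    by apply/seteqP; split => w /=; rewrite lt0n; [move=> -> | move/negP/negPn/eqP].
  rewrite probability_setC ?hJ0 ?subee //.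
  rewrite -[X in measurable X]setTI.
  exact: (measurable_funPT J measurableT [set k | (0 < k)%N]).
rewrite -pgf0 -[pgf pi 0]/(phi 0) -N_intA // -N_intX //; congr N_int.
apply/funext => k; rewrite /A h0 big1 ?addr0 // => j _.
by rewrite mul0r mulr0.
Qed.

End StationaryEquation.

(** * The mass of the stationary law at 0 *)

Theorem theorem3p4 (d : measure_display) (T : measurableType d) (R : realType)
  (P : probability T R)
  (I J K X : {RV P >-> nat})
  (I_ J_ K_ : nat -> {RV P >-> nat}) (X_ : nat -> nat -> {RV P >-> nat})
  (p : R)
  (hJ : P [set w | (0 < J w)%N] = 1%E)
  (hp : 0 < p < 1)
  (hK : geometric_law P p K)
  (hI_ : forall n : nat, same_law (I_ n) I)
  (hJ_ : forall n : nat, same_law (J_ n) J)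
  (hK_ : forall n : nat, same_law (K_ n) K)
  (hX_ : forall m n : nat, same_law (X_ m n) X)
  (hind : mutually_independent P (innovation I_ J_ K_ X_))
  (hvar : 0 < var P X)
  (hJ2 : ('E_P[natR R J ^+ 2] < +oo)%E)
  (hI2 : ('E_P[natR R I ^+ 2] < +oo)%E)
  (hX1 : ('E_P[natR R X] = 1)%E)
  (hX3 : ('E_P[natR R X ^+ 3] < +oo)%E)
  (hirr : irreducible (trans_prob P I_ J_ K_ X_))
  (haper : aperiodic (trans_prob P I_ J_ K_ X_))
  (htheta : theta P I J K X < 0)
  (pi : probability nat R)
  (hpi : stationary (trans_prob P I_ J_ K_ X_) pi) :
  pi [set 0%N] =
  ((mean P I + mean P J - mean P K) / (mean P J - mean P K))%:E.
Proof.
have hK0 : geometric_law P p (K_ 0%N).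
  move=> k; rewrite -hK; exact: (hK_ 0%N [set k]).
have hX0 m : same_law (X_ m 0%N) X by [].
rewrite (stationary_atom0 hind hp hK0 (hI_ 0%N) (hJ_ 0%N) hX0 hpi hJ).
rewrite !expectation_natR_exp in hJ2 hI2 hX3; rewrite expectation_natR in hX1.
have hX2 : (moment (distribution P X) 2 < +oo)%E.
  by apply: le_lt_trans hX3; exact: moment_le.
have meanE (Z : {RV P >-> nat}) : mean P Z = fine (moment (distribution P Z) 1).
  by rewrite /mean expectation_natR.
have q0 : 0 < fine (distribution P X [set k | (2 <= k)%N]).
  apply: nondegenerate_mass_ge2 => //.
  move: hvar; rewrite /var /variance unlock expectation_natR hX1 /= unlock.
  rewrite -(same_law_integral (Z := X) (Z' := X)
    (F := fun k => (k%:R - 1) ^+ 2)) //; last first.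
    by move=> k; exact: sqr_ge0.
  set V := (X in fine X) => V0.
  have -> : (\int[P]_w (((X w)%:R - 1) ^+ 2)%:E)%E = V by [].
  by move: V0; case: V => [v| |] //=; rewrite ?ltxx.
have EX := pgf_expands hX2; rewrite hX1 /= in EX.
have cX (u : R) : 0 <= u <= 1 ->
    1 - u + fine (distribution P X [set k | (2 <= k)%N]) * u ^+ 2 <=
    pgf (distribution P X) (1 - u).
  move=> u01; have := pgf_curvature (m := distribution P X) _ u01.
  by rewrite hX1 /= mul1r; apply; rewrite ltry.
have lim := functional_equation_drift hp q0 EX cX (pgf_expands hI2)
  (pgf_expands hJ2) (fun u u01 cu => pgf_cvg1 pi u01 cu)
  (stationary_pgf hind hp hK0 (hI_ 0%N) (hJ_ 0%N) hX0 hpi).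
have drift0 : mean P I + mean P J - mean P K < 0.
  by move: htheta; rewrite /theta pmulr_rlt0 // divr_gt0.
rewrite -!meanE -(geometric_mean hp hK) in lim.
have mI0 : 0 <= mean P I.
  by rewrite meanE; apply/fine_ge0/integral_ge0 => k _; rewrite lee_fin.
have b0 : mean P J - mean P K != 0 by rewrite lt_eqF //; lra.
congr EFin; apply: (mulIf b0); rewrite mulfVK //; lra.
Qed.
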